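(* Let $\epsilon>0$. If $f$ is a concave function, then performing Algorithm 1 with $\alpha_k=1$ for all $k$ (i.e. $x^1\in S$ and $x^{k+1}\in\arg\min_{y\in S}\{f(x^k)+\nabla f(x^k)^{\top}(y-x^k)+h(y)\}$ for $k\ge1$) reaches an $\epsilon$-stationary point of $\min_{x\in S}\Phi(x)$ within $$N=\left\lceil\frac{\Phi(x^1)-\Phi^*}{\epsilon}\right\rceil$$ steps; that is, there is an index $1\le k\le\max\{1,N\}$ such that $x^k$ is an $\epsilon$-stationary point.
   Context: $S\subseteq\mathbf R^n$ is nonempty, compact and convex; $f:\mathbf R^n\to\mathbf R$ is differentiable; $h:\mathbf R^n\to\mathbf R$ is convex (possibly nonsmooth); $\Phi=f+h$ and $\Phi^*=\min_{x\in S}\Phi(x)$. A point $x\in S$ is an $\epsilon$-stationary point of $\min_{x\in S}\Phi(x)$ if $\nabla f(x)^{\top}(y-x)+h(y)-h(x)\ge-\epsilon$ for all $y\in S$. *)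

(* Defs.v *)
From HB Require Import structures.
From mathcomp Require Import all_boot all_order all_algebra.
From mathcomp Require Import all_classical all_reals all_analysis.

Set Implicit Arguments.
Unset Strict Implicit.
Unset Printing Implicit Defensive.

Import Order.TTheory GRing.Theory Num.Theory.
Import numFieldNormedType.Exports.

Local Open Scope classical_set_scope.
Local Open Scope ring_scope.

(* R^n is 'rV[R]_n; its sup-norm induces the usual topology, and hence the
   usual compact sets and (Frechet) differentiable functions. *)

Definition concave_function (R : realType) (n : nat) (D : set 'rV[R]_n)
    (f : 'rV[R]_n -> R) : Prop :=
  convex_function D (fun x => - f x).

Definition dotp (R : realType) (n : nat) (u v : 'rV[R]_n) : R :=
  \sum_(i < n) u 0 i * v 0 i.

Definition gradient (R : realType) (n : nat) (f : 'rV[R]_n -> R)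
    (x : 'rV[R]_n) : 'rV[R]_n :=
  \row_(i < n) 'D_(delta_mx 0 i) f x.

Definition is_min (R : realType) (A : set R) (m : R) : Prop :=
  A m /\ lbound A m.

Definition argmin (R : realType) (T : Type) (S : set T) (g : T -> R) : set T :=
  [set x | S x /\ forall y, S y -> g x <= g y].

Definition eps_stationary (R : realType) (n : nat) (S : set 'rV[R]_n)
    (f h : 'rV[R]_n -> R) (eps : R) (x : 'rV[R]_n) : Prop :=
  S x /\ forall y, S y -> - eps <= dotp (gradient f x) (y - x) + h y - h x.

(* Iterates are numbered from 1; the value [x 0] is irrelevant. *)
Definition unit_step_iterates (R : realType) (n : nat) (S : set 'rV[R]_n)
    (f h : 'rV[R]_n -> R) (x : nat -> 'rV[R]_n) : Prop :=
  S (x 1%N) /\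
  forall k : nat, (1 <= k)%N ->
    argmin S (fun y => f (x k) + dotp (gradient f (x k)) (y - x k) + h y)
      (x k.+1).

(* Main.v *)
Require Import Defs.
From HB Require Import structures.
From mathcomp Require Import all_boot all_order all_algebra.
From mathcomp Require Import all_classical all_reals all_analysis.
From mathcomp Require Import lra.

Set Implicit Arguments.
Unset Strict Implicit.
Unset Printing Implicit Defensive.

Import Order.TTheory GRing.Theory Num.Theory.
Import numFieldNormedType.Exports.

Local Open Scope classical_set_scope.
Local Open Scope ring_scope.

(** A unit step minimizes over [S] the model obtained from [f + h] by
    linearizing [f] at the current iterate.  The amount by which the step
    decreases the model, its gap, controls stationarity: the iterate is
    [eps]-stationary as soon as its gap is at most [eps], because the next
    iterate is the worst competitor in the definition of stationarity.  When
    [f] is concave its linearization is a global upper bound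
    ([concave_gradient_ub]), so [f + h] itself decreases by at least the gap
    ([unit_step_stationary]).  Finally, [f + h] cannot drop below its minimum
    over [S], so among [N] consecutive steps one decreases it by at most
    [eps] whenever the initial excess over that minimum is at most
    [N * eps] ([exists_small_decrease]). *)

(** The difference quotients of [f] at [x] along [y - x] with
    positive steps at most [1] lie below the one with step [1], which is
    [f y - f x]; the bound passes to the limit. *)
Lemma convex_derive_le (R : realType) (V : normedModType R) (D : set V)
    (f : V -> R) (x y : V) :
  convex_function D f -> D x -> D y -> derivable f x (y - x) ->
  'D_(y - x) f x <= f y - f x.
Proof.
move=> cf Dx Dy dfx; rewrite /derive.
(* Convexity bounds the quotients only for positive steps. *)
rewrite cvg_at_rightE//; apply: limr_le.
  exact: cvgP (cvg_dnbhs_at_right dfx).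
near=> t.
have t0 : 0 < t by near: t; exact: nbhs_right_gt.
have t1 : t <= 1 by near: t; exact: nbhs_right_le.
have := cf (Itv01 (ltW t0) t1) y x (mem_set Dy) (mem_set Dx).
rewrite convRE [conv _ _ _](_ : _ = t *: (y - x) + x); last first.
  by rewrite /conv/= /unstable.onem scalerBr scalerBl scale1r addrA addrAC.
rewrite /= /unstable.onem ler_pdivrMl// => le_conv.
by move: le_conv; lra.
Unshelve. all: by end_near. Qed.

Lemma dotp_gradient (R : realType) (n : nat) (f : 'rV[R]_n -> R)
    (x v : 'rV[R]_n) :
  differentiable f x -> dotp (gradient f x) v = 'D_v f x.
Proof.
move=> dfx; rewrite deriveE// [in RHS](row_sum_delta v) linear_sum.
apply: eq_bigr => i _.
by rewrite linearZ/= mxE deriveE// mulrC.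
Qed.

Lemma concave_gradient_ub (R : realType) (n : nat) (D : set 'rV[R]_n)
    (f : 'rV[R]_n -> R) (x y : 'rV[R]_n) :
  concave_function D f -> D x -> D y -> differentiable f x ->
  f y - f x <= dotp (gradient f x) (y - x).
Proof.
move=> cf Dx Dy dfx; have dv : derivable f x (y - x) by exact: diff_derivable.
have := convex_derive_le cf Dx Dy (derivableN dv).
by rewrite deriveN// dotp_gradient//; lra.
Qed.

(** The actual decrease of [f + h] is at least the decrease of the model, by
    concavity, and the latter is the largest value over [y] in [S] of the
    quantity that stationarity bounds by [eps]. *)
Lemma unit_step_stationary (R : realType) (n : nat) (S : set 'rV[R]_n)
    (f h : 'rV[R]_n -> R) (eps : R) (x x' : 'rV[R]_n) :
  concave_function S f -> differentiable f x -> S x ->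
  argmin S (fun y => f x + dotp (gradient f x) (y - x) + h y) x' ->
  (f x + h x) - (f x' + h x') <= eps -> eps_stationary S f h eps x.
Proof.
move=> cf dfx Sx [Sx' x'_min] small; split=> // y Sy.
have := concave_gradient_ub cf Sx Sx' dfx.
by have := x'_min y Sy; lra.
Qed.

(** The decreases over the [N] steps telescope to at most [u m - l], so they
    cannot all exceed [eps]. *)
Lemma exists_small_decrease (R : realDomainType) (u : nat -> R) (l eps : R)
    (m N : nat) :
  (0 < N)%N -> l <= u (m + N)%N -> u m - l <= N%:R * eps ->
  exists k : nat, [/\ (m <= k)%N, (k < m + N)%N & u k - u k.+1 <= eps].
Proof.
move=> N0 lu uN; apply: contrapT => noK.
have big_step k : (m <= k < m + N)%N -> eps < u k - u k.+1.
  move=> /andP[mk kN]; rewrite ltNge; apply/negP => small.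
  by apply: noK; exists k.
have : \sum_(m <= k < m + N) eps < \sum_(m <= k < m + N) (u k - u k.+1).
  by apply: ltr_sum_nat => //; rewrite -[ltnLHS]addn0 ltn_add2l.
rewrite sumr_const_nat addKn -mulr_natl.
rewrite -[ltRHS]opprK -sumrN.
under [in ltRHS]eq_bigr do rewrite opprB.
rewrite telescope_sumr ?leq_addr//; lra.
Qed.

Theorem corollary3p2 (R : realType) (n : nat) (S : set 'rV[R]_n)
    (f h : 'rV[R]_n -> R) (Phistar eps : R) (x : nat -> 'rV[R]_n)
    (S_nonempty : S !=set0) (S_compact : compact S) (S_convex : convex_set S)
    (f_diff : forall z, differentiable f z)
    (h_convex : convex_function setT h)
    (Phistar_min : is_min [set f z + h z | z in S] Phistar)
    (eps_gt0 : 0 < eps)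
    (f_concave : concave_function setT f)
    (x_iterates : unit_step_iterates S f h x) :
  exists k : nat,
    [/\ (1 <= k)%N,
        k%:Z <= Num.max 1 (Num.ceil ((f (x 1%N) + h (x 1%N) - Phistar) / eps))
      & eps_stationary S f h eps (x k)].
Proof.
have [Sx1 x_step] := x_iterates.
have Sx k : (1 <= k)%N -> S (x k).
  by case: k => [//|[//|k]] _; have [] := x_step k.+1 isT.
have Phi_ge k : (1 <= k)%N -> Phistar <= f (x k) + h (x k).
  by move=> /Sx Sxk; apply: Phistar_min.2; exists (x k).
have f_concaveS : concave_function S f.
  by move=> t y z _ _; apply: f_concave; exact: in_setT.
set q := _ / eps; set M := Num.max 1 _.
have M1 : 1 <= M by rewrite le_max lexx.
have [N MN] : exists N : nat, M = N%:Z.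
  by exists `|M|%N; rewrite gez0_abs// (le_trans _ M1).
have N0 : (0 < N)%N by rewrite -ltz_nat -MN (lt_le_trans _ M1).
have excess_le : f (x 1%N) + h (x 1%N) - Phistar <= N%:R * eps.
  rewrite -ler_pdivrMr// -/q pmulrn -ceil_le_int.
  by rewrite -MN le_max lexx orbT.
have [k [k1 kN small]] := exists_small_decrease (u := fun k => f (x k) + h (x k))
  N0 (Phi_ge (1 + N)%N isT) excess_le.
exists k; split=> //; first by rewrite MN lez_nat -ltnS.
exact: unit_step_stationary f_concaveS (f_diff _) (Sx k k1) (x_step k k1) small.
Qed.
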